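(* Let $A\subseteq R$ be an extension of additively idempotent semirings. Let $$X:=\{x\in R : \text{there is a faithful } A[x]\text{-module that is finitely generated as an } A\text{-module}\}.$$ Then the D-integral closure $\overline{A}^{\mathrm{D}}$ of $A$ in $R$ is equal to the downward closure of $X$ in $R$, i.e. to $\{y\in R : y\le x \text{ for some } x\in X\}$.
   Context: Semirings are commutative, with $0$ and $1$, satisfy $a\cdot 0=0$, and are additively idempotent ($a+a=a$). The partial order is $a\le b\iff a+b=b$. $A$ is a sub-semiring of $R$ and $A[x]$ denotes the sub-semiring of $R$ generated by $A$ and $x$. An $R'$-module $M$ (for a semiring $R'$) is faithful if whenever $a,b\in R'$ satisfy $am=bm$ for all $m\in M$, then $a=b$. An $A$-module $M$ is finitely generated if there is a surjective $A$-module homomorphism $A^n\to M$ for some $n\in\mathbb{N}$. An element $y\in R$ is J-integral over $A$ if there are a positive integer $n$ and $a_0,\dots,a_{n-1}\in A$ with $y^n\le\sum_{i=0}^{n-1}a_iy^i$. An element $x\in R$ is D-integral over $A$ if there is $y\in R$ that is J-integral over $A$ with $x\le y$. $\overline{A}^{\mathrm{D}}$ is the set of elements of $R$ that are D-integral over $A$. *)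

(* Defs.v *)
From HB Require Import structures.
From mathcomp Require Import all_boot all_algebra.
From mathcomp Require Import boolp classical_sets.

Set Implicit Arguments.
Unset Strict Implicit.
Unset Printing Implicit Defensive.

Import GRing.Theory.
Local Open Scope ring_scope.
Local Open Scope classical_set_scope.

Definition idem_le (R : comPzSemiRingType) (a b : R) : Prop := a + b = b.

Definition down_closure (R : comPzSemiRingType) (X : set R) : set R :=
  [set y | exists2 x, X x & idem_le y x].

Record subsemiring (R : comPzSemiRingType) (A : semiringClosed R) : Type :=
  Subsemiring { subsemiring_val : R; _ : subsemiring_val \in A }.

Section SubsemiringStructure.
Variables (R : comPzSemiRingType) (A : semiringClosed R).

HB.instance Definition _ := [isSub for @subsemiring_val R A].
HB.instance Definition _ := [Choice of subsemiring A by <:].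
HB.instance Definition _ :=
  GRing.SubChoice_isSubComPzSemiRing.Build R _ (subsemiring A)
    (semiringClosedP A).

End SubsemiringStructure.

(* [semiringClosed R] packages boolean predicates; since `[< _ >] turns any
   proposition into a boolean, [S] ranges over all the sub-semirings of [R]. *)
Definition adjoin (R : comPzSemiRingType) (A : semiringClosed R) (x : R) :
    {pred R} :=
  fun z => `[< forall S : semiringClosed R,
                 {subset A <= S} -> x \in S -> z \in S >].

Section AdjoinStructure.
Variables (R : comPzSemiRingType) (A : semiringClosed R) (x : R).

Lemma adjoinP z :
  reflect (forall S : semiringClosed R,
             {subset A <= S} -> x \in S -> z \in S)
          (z \in adjoin A x).
Proof. exact: asboolP. Qed.

Fact adjoin_semiring_closed : semiring_closed (adjoin A x).
Proof.
split; split=> [|a b /adjoinP aA /adjoinP bA]; apply/adjoinP => S AS xS.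
- exact: rpred0.
- by apply: rpredD; [apply: aA | apply: bA].
- exact: rpred1.
- by apply: rpredM; [apply: aA | apply: bA].
Qed.

HB.instance Definition _ :=
  GRing.isSemiringClosed.Build R (adjoin A x) adjoin_semiring_closed.

Lemma sub_adjoin : {subset A <= adjoin A x}.
Proof. by move=> a aA; apply/adjoinP => S AS _; apply: AS. Qed.

Lemma mem_adjoin : x \in adjoin A x.
Proof. by apply/adjoinP. Qed.

Definition adjoin_incl (a : subsemiring A) : subsemiring (adjoin A x) :=
  Subsemiring (sub_adjoin (valP a)).

Fact adjoin_incl_nmod_morphism : nmod_morphism adjoin_incl.
Proof. by split=> [|a b]; apply: val_inj. Qed.

HB.instance Definition _ :=
  GRing.isNmodMorphism.Build (subsemiring A) (subsemiring (adjoin A x))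
    adjoin_incl adjoin_incl_nmod_morphism.

Fact adjoin_incl_monoid_morphism : monoid_morphism adjoin_incl.
Proof. by split=> [|a b]; apply: val_inj. Qed.

HB.instance Definition _ :=
  GRing.isMonoidMorphism.Build (subsemiring A) (subsemiring (adjoin A x))
    adjoin_incl adjoin_incl_monoid_morphism.

End AdjoinStructure.

Definition restrict_scalars (A B : pzSemiRingType) (iota : {rmorphism A -> B})
  (M : lSemiModType B) : Type := M.

Section RestrictScalars.
Variables (A B : pzSemiRingType) (iota : {rmorphism A -> B}).
Variable M : lSemiModType B.

Local Notation scale_res := (fun (a : A) (m : M) => iota a *: m).

Fact restrict_scalerA a b m :
  scale_res a (scale_res b m) = scale_res (a * b) m.
Proof. by rewrite /= rmorphM scalerA. Qed.

Fact restrict_scale0r m : scale_res 0 m = 0.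
Proof. by rewrite /= rmorph0 scale0r. Qed.

Fact restrict_scale1r : left_id 1 scale_res.
Proof. by move=> m; rewrite /= rmorph1 scale1r. Qed.

Fact restrict_scalerDr : right_distributive scale_res +%R.
Proof. by move=> a m1 m2; rewrite /= scalerDr. Qed.

Fact restrict_scalerDl m : {morph scale_res^~ m : a b / a + b}.
Proof. by move=> a b; rewrite /= rmorphD scalerDl. Qed.

HB.instance Definition _ := GRing.Nmodule.on (restrict_scalars iota M).
HB.instance Definition _ :=
  GRing.Nmodule_isLSemiModule.Build A (restrict_scalars iota M)
    restrict_scalerA restrict_scale0r restrict_scale1r
    restrict_scalerDr restrict_scalerDl.

End RestrictScalars.

Definition faithful_module (A : pzSemiRingType) (M : lSemiModType A) : Prop :=
  forall a b : A, (forall m : M, a *: m = b *: m) -> a = b.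

Definition finitely_generated (A : pzSemiRingType) (M : lSemiModType A) :
    Prop :=
  exists (n : nat) (f : {linear 'rV[A]_n -> M}), forall m : M, exists v, f v = m.

Definition J_integral (R : comPzSemiRingType) (A : semiringClosed R) (y : R) :
    Prop :=
  exists (n : nat) (a : 'I_n -> R),
    [/\ (0 < n)%N, forall i, a i \in A
      & idem_le (y ^+ n) (\sum_(i < n) a i * y ^+ i)].

Definition D_integral (R : comPzSemiRingType) (A : semiringClosed R) (x : R) :
    Prop :=
  exists2 y : R, J_integral A y & idem_le x y.

Definition D_closure (R : comPzSemiRingType) (A : semiringClosed R) : set R :=
  [set x | D_integral A x].

Definition fg_faithful_set (R : comPzSemiRingType) (A : semiringClosed R) :
    set R :=
  [set x | exists M : lSemiModType (subsemiring (adjoin A x)),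
      faithful_module M /\
      finitely_generated (restrict_scalars (@adjoin_incl R A x) M)].

(* Main.v *)
Require Import Defs.
From HB Require Import structures.
From mathcomp Require Import all_boot all_algebra.
From mathcomp Require Import boolp classical_sets.

Set Implicit Arguments.
Unset Strict Implicit.
Unset Printing Implicit Defensive.

Import GRing.Theory.
Local Open Scope ring_scope.

(** Both inclusions hold up to enlarging elements, and idempotence makes
    enlarging harmless.

    If [y] is J-integral, with coefficients [c i], put [a = 1 + \sum_i c i] and
    [z = a + y].  Then [z] dominates [1], [a] and [y], every mixed monomial in
    [a] and [y] of degree [n.+1] is below [a * z ^+ n], and so is [y ^+ n.+1]
    by J-integrality; hence [z ^+ n.+1 = a * z ^+ n]
    ([exprD_eq_of_expr_le]).  An equation of this form makes [A[z]] an
    [A]-module spanned by [1, z, ..., z ^+ n] ([adjoin_sub_power_span]), and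
    [A[z]] is a faithful module over itself since it contains [1].  So [y] lies
    below the element [z] of [fg_faithful_set A] ([J_integral_le_fg]).

    Conversely, let [M] be a faithful [A[x]]-module with [A]-generators [m i],
    and write [x *: m i = \sum_j c i j *: m j].  In place of the determinant
    trick, which needs signs, expand [x ^+ n *: m i] along walks in the complete
    digraph on the indices, an edge from [i] to [j] weighing [c i j].  A walk
    with [n] edges revisits a vertex; cutting out the closed part up to that
    visit, whose weight is at most a power of [a = \sum_(i, j) c i j], leaves a
    shorter walk from [i], bounded by a smaller power of [x] applied to [m i].
    Sums being joins, this gives
    [x ^+ n *: m i <= (\sum_(l < n) a ^+ (n - l) * x ^+ l) *: m i]
    ([exprZ_le_walk_bound]).  The polynomial does not depend on [i], so the
    inequality holds on all of [M], and faithfulness turns it into an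
    inequality in [A[x]]: [x] itself is J-integral ([J_integral_of_fg]). *)

(** * The order of an idempotent addition *)

(** The form of [idem_le] that applies to semirings and to their modules alike;
    on a semiring the two are convertible. *)
Definition add_le (V : nmodType) (u v : V) : Prop := u + v = v.

Section AddLe.
Variable V : nmodType.
Hypothesis addVV : idempotent_op (@GRing.add V).
Implicit Types u v w : V.

Lemma add_le_refl u : add_le u u.
Proof. exact: addVV. Qed.

Lemma add_le_trans v u w : add_le u v -> add_le v w -> add_le u w.
Proof. by rewrite /add_le => uv vw; rewrite -vw addrA uv. Qed.

Lemma add_le_join u v w : add_le u w -> add_le v w -> add_le (u + v) w.
Proof. by rewrite /add_le -addrA => uw ->. Qed.

Lemma add_le_addl u v : add_le u (u + v).
Proof. by rewrite /add_le addrA addVV. Qed.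

Lemma add_le_addr u v : add_le u (v + u).
Proof. by rewrite addrC; apply: add_le_addl. Qed.

Lemma add_le_sum_lub (I : Type) (r : seq I) (P : pred I) (F : I -> V) w :
  (forall i, P i -> add_le (F i) w) -> add_le (\sum_(i <- r | P i) F i) w.
Proof.
move=> Fw; elim/big_rec: _ => [|i u Pi uw]; first exact: add0r.
by apply: add_le_join => //; apply: Fw.
Qed.

Lemma add_le_sum (I : finType) (F : I -> V) i : add_le (F i) (\sum_j F j).
Proof. by rewrite (bigD1 i) //=; apply: add_le_addl. Qed.

End AddLe.

Section AddLeScale.
Variables (B : comPzSemiRingType) (M : lSemiModType B).
Hypothesis addBB : idempotent_op (@GRing.add B).

Lemma module_addrr : idempotent_op (@GRing.add M).
Proof. by move=> m; rewrite -{1 2}[m]scale1r -scalerDl addBB scale1r. Qed.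

Lemma add_leZ c (u v : M) : add_le u v -> add_le (c *: u) (c *: v).
Proof. by rewrite /add_le -scalerDr => ->. Qed.

Lemma add_leZl c d (m : M) : add_le c d -> add_le (c *: m) (d *: m).
Proof. by rewrite /add_le -scalerDl => ->. Qed.

Lemma add_leM (b c d : B) : add_le c d -> add_le (b * c) (b * d).
Proof. by rewrite /add_le -mulrDr => ->. Qed.

Lemma add_leM2 (a b c d : B) :
  add_le a b -> add_le c d -> add_le (a * c) (b * d).
Proof.
move=> ab cd; apply: (@add_le_trans _ (a * d)); first exact: add_leM.
by rewrite ![_ * d]mulrC; apply: add_leM.
Qed.

Lemma add_leX (a b : B) n : add_le a b -> add_le (a ^+ n) (b ^+ n).
Proof.
move=> ab; elim: n => [|n IHn]; first by rewrite !expr0; apply: add_le_refl.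
by rewrite !exprS; apply: add_leM2.
Qed.

Lemma add_leX_exp (a : B) i n :
  add_le 1 a -> (i <= n)%N -> add_le (a ^+ i) (a ^+ n).
Proof.
move=> a1 le_in; rewrite -(subnKC le_in) exprD -{1}[a ^+ i]mulr1.
by apply: add_leM; rewrite -(expr1n _ (n - i)); apply: add_leX.
Qed.

End AddLeScale.

(** * A Cayley-Hamilton inequality from walks *)

Section WalkBound.
Variable B : comPzSemiRingType.
Hypothesis addBB : idempotent_op (@GRing.add B).
Implicit Types a x : B.

(** Homogeneous of degree [n] in [a] and [x]: a walk of length [n] that loses
    [n - l] edges is charged [a] for each lost edge and [x] for each kept one. *)
Definition walk_bound n a x : B := \sum_(l < n) a ^+ (n - l) * x ^+ l.

Lemma walk_boundS n a x :
  walk_bound n.+1 a x = a ^+ n.+1 + x * walk_bound n a x.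
Proof.
rewrite /walk_bound big_ord_recl subn0 expr0 mulr1 mulr_sumr; congr (_ + _).
by apply: eq_bigr => l _; rewrite exprS mulrCA subSS.
Qed.

Variables (M : lSemiModType B) (n : nat) (x a : B).
Variables (c : 'I_n -> 'I_n -> B) (m : 'I_n -> M).
Hypothesis xm : forall i, x *: m i = \sum_j c i j *: m j.
Hypothesis c_le_a : forall i j, add_le (c i j) a.

Lemma walk_step_le w i j : add_le ((w * c i j) *: m j) ((x * w) *: m i).
Proof.
rewrite [x * w]mulrC -!scalerA xm; apply: add_leZ.
exact: (add_le_sum (module_addrr (M := M) addBB) (fun j => c i j *: m j)).
Qed.

Lemma walk_weight_le w (i j k : 'I_n) :
  add_le ((w * c i j) *: m k) ((a * w) *: m k).
Proof. by apply: add_leZl; rewrite [a * w]mulrC; apply: add_leM. Qed.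

(** The walk, of weight [w] and length [#|V|], is back at a vertex [j] that it
    visited after [l] steps.  The [#|V| - l] edges since then cost powers of
    [a], the first [l] and the [n - #|V|] still to come cost powers of [x];
    fewer than [n] powers of [x] are used in all. *)
Lemma walk_back_le (i j : 'I_n) (V : {set 'I_n}) (w : B) :
    j \in V ->
    (forall v, v \in V -> exists2 l, (l < #|V|)%N &
       add_le (w *: m v) ((a ^+ (#|V| - l) * x ^+ l) *: m i)) ->
  add_le ((x ^+ (n - #|V|) * w) *: m j) (walk_bound n a x *: m i).
Proof.
move=> jV wV; have [l lV wl] := wV j jV.
have Vn : (#|V| <= n)%N by rewrite -[n in leqRHS]card_ord max_card.
have ln : (n - #|V| + l < n)%N by rewrite -[ltnRHS](subnK Vn) ltn_add2l.
apply: (@add_le_trans _ ((a ^+ (#|V| - l) * x ^+ (n - #|V| + l)) *: m i)).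
  by rewrite exprD mulrCA -!scalerA; apply: add_leZ; rewrite scalerA.
have -> : (#|V| - l = n - (n - #|V| + l))%N by rewrite subnDA subKn.
apply: add_leZl.
exact: (add_le_sum addBB (fun l : 'I_n => a ^+ (n - l) * x ^+ l) (Ordinal ln)).
Qed.

(** The remaining [n - #|V|] steps of a walk from [i] which stands at [j] with
    weight [w], its previous vertices forming the set [V], all distinct.  The
    hypotheses keep what the induction needs to know of the walk: its own
    term, and, for each past vertex [v], the bound on [w *: m v] obtained by
    truncating the walk at [v].  As long as the walk visits new vertices [V]
    grows, and there are only [n] indices to fill it with. *)
Lemma walk_term_le (i j : 'I_n) (V : {set 'I_n}) (w : B) :
    add_le (w *: m j) (x ^+ #|V| *: m i) ->
    (forall v, v \in V -> exists2 l, (l < #|V|)%N &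
       add_le (w *: m v) ((a ^+ (#|V| - l) * x ^+ l) *: m i)) ->
  add_le ((x ^+ (n - #|V|) * w) *: m j) (walk_bound n a x *: m i).
Proof.
move: {2}(n - #|V|)%N (erefl (n - #|V|)%N) => r.
elim: r => [|r IHr] in j V w * => nV wj wV.
(* with no step left, [V] contains all the indices, so [j] is a revisit *)
all: have [jV|jV] := boolP (j \in V); first exact: walk_back_le.
  have: (#|j |: V| <= n)%N by rewrite -[n in leqRHS]card_ord max_card.
  by rewrite cardsU1 jV add1n -subn_gt0 nV.
have VnS : (n - #|j |: V| = r)%N by rewrite cardsU1 jV add1n subnS nV.
have VS : #|j |: V| = #|V|.+1 by rewrite cardsU1 jV.
rewrite nV exprSr -mulrA -scalerA [x * w]mulrC -scalerA xm !scaler_sumr.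
apply: add_le_sum_lub => k _; rewrite !scalerA -VnS -mulrA.
apply: IHr => // [|v]; rewrite VS.
  apply: (add_le_trans (walk_step_le w j k)).
  by rewrite exprS -!scalerA; apply: add_leZ.
(* truncating at [j] itself drops only the edge just taken *)
case/setU1P => [->|vV].
  exists #|V| => //; rewrite subSnn expr1.
  by apply: (add_le_trans (walk_weight_le w j k j)); rewrite -!scalerA; apply: add_leZ.
have [l lV wl] := wV v vV; exists l; first exact: ltnW.
apply: (add_le_trans (walk_weight_le w j k v)).
by rewrite subSn ?(ltnW lV) // exprS -!mulrA -![(a * _) *: _]scalerA; apply: add_leZ.
Qed.

Lemma exprZ_le_walk_bound i : add_le (x ^+ n *: m i) (walk_bound n a x *: m i).
Proof.
have := @walk_term_le i i finset.set0 1; rewrite cards0 subn0 expr0 mulr1; apply.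
  exact/add_le_refl/(module_addrr (M := M) addBB).
by move=> v; rewrite inE.
Qed.

End WalkBound.

(** * Finite generation from a monomial equation *)

Section PowerSpan.
Variables (R : comPzSemiRingType) (A : semiringClosed R).

Definition power_span (n : nat) (z : R) : {pred R} :=
  fun r => `[< exists2 v : 'I_n -> R, forall i, v i \in A
                                    & r = \sum_(i < n) v i * z ^+ i >].

Lemma power_spanP n z r :
  reflect (exists2 v : 'I_n -> R, forall i, v i \in A
                                & r = \sum_(i < n) v i * z ^+ i)
          (r \in power_span n z).
Proof. exact: asboolP. Qed.

Variables (n : nat) (a z : R).
Hypotheses (aA : a \in A) (zS : z ^+ n.+1 = a * z ^+ n).

Lemma power_span0 : 0 \in power_span n.+1 z.
Proof.
apply/power_spanP; exists (fun=> 0) => [i|]; first exact: rpred0.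
by rewrite big1 // => i _; rewrite mul0r.
Qed.

Lemma power_spanD : {in power_span n.+1 z &, forall r s, r + s \in power_span n.+1 z}.
Proof.
move=> _ _ /power_spanP[v vA ->] /power_spanP[w wA ->]; apply/power_spanP.
exists (fun i => v i + w i) => [i|]; first by rewrite rpredD.
by rewrite -big_split; apply: eq_bigr => i _; rewrite mulrDl.
Qed.

Lemma power_span_monomial b i : b \in A -> b * z ^+ i \in power_span n.+1 z.
Proof.
wlog lt_in : b i / (i < n.+1)%N => [reduced|] bA.
  have [|lt_ni] := ltnP i n.+1; first by move=> ?; apply: reduced.
  have zn k : z ^+ (n + k) = a ^+ k * z ^+ n.
    elim: k => [|k IHk]; first by rewrite addn0 mul1r.
    by rewrite addnS exprS IHk mulrCA -exprS zS mulrA -exprSr.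
  rewrite -(subnKC (ltnW lt_ni)) zn mulrA.
  by apply: reduced; rewrite ?rpredM ?rpredX.
apply/power_spanP; exists (fun k => if k == i :> nat then b else 0) => [k|].
  by case: eqP => // _; apply: rpred0.
rewrite (bigD1 (Ordinal lt_in)) //= eqxx big1 ?addr0 // => k.
by rewrite -val_eqE /= => /negPf->; rewrite mul0r.
Qed.

Lemma power_span_sum (I : finType) (F : I -> R) :
  (forall i, F i \in power_span n.+1 z) -> \sum_i F i \in power_span n.+1 z.
Proof.
move=> Fz; elim/big_ind: _ => // [|r s rz sz]; first exact: power_span0.
exact: power_spanD.
Qed.

(** Products of spanning monomials have degree up to [2 * n]; the equation for
    [z ^+ n.+1] brings them back to degree at most [n]. *)
Lemma power_span_semiring_closed : semiring_closed (power_span n.+1 z).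
Proof.
split; split; [exact: power_span0 | exact: power_spanD | |].
  by rewrite -[1](mulr1 1) -[X in _ * X](expr0 z) power_span_monomial ?rpred1.
move=> _ _ /power_spanP[v vA ->] /power_spanP[w wA ->].
rewrite mulr_suml; apply: power_span_sum => i.
rewrite mulr_sumr; apply: power_span_sum => j.
by rewrite mulrACA -exprD power_span_monomial ?rpredM.
Qed.

Lemma adjoin_sub_power_span : {subset adjoin A z <= power_span n.+1 z}.
Proof.
pose S : semiringClosed R := HB.pack (power_span n.+1 z)
  (GRing.isSemiringClosed.Build R (power_span n.+1 z)
     power_span_semiring_closed).
move=> r /adjoinP/(_ S); apply=> [b bA|].
  by rewrite -[b](mulr1 b) -(expr0 z); apply: power_span_monomial.
by rewrite -[z in z \in _]mul1r -[X in _ * X](expr1 z); apply/power_span_monomial/rpred1.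
Qed.

(** The module is [A[z]] itself, with its own multiplication as scaling. *)
Lemma fg_faithful_of_pow_eq : fg_faithful_set A z.
Proof.
pose B := subsemiring (adjoin A z).
pose Z : B := Subsemiring (mem_adjoin A z).
exists (B^o : lSemiModType B); split.
  by move=> b c /(_ 1); rewrite /GRing.scale /= !mulr1.
pose f (v : 'rV[subsemiring A]_n.+1) :
    restrict_scalars (@adjoin_incl R A z) (B^o : lSemiModType B) :=
  \sum_i (adjoin_incl z (v 0 i) * Z ^+ i : B).
have f_linear : GRing.semilinear_for *:%R f.
  split=> [c v|v w].
    rewrite scaler_sumr; apply: eq_bigr => i _.
    by rewrite mxE rmorphM -mulrA.
  rewrite -big_split; apply: eq_bigr => i _ /=.
  by rewrite mxE rmorphD mulrDl.
pose fL : {linear 'rV[subsemiring A]_n.+1 -> _} :=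
  HB.pack f (GRing.isSemilinear.Build _ _ _ _ f f_linear).
exists n.+1, fL => b.
have /power_spanP[v vA bE] := adjoin_sub_power_span (valP b).
exists (\row_i Subsemiring (vA i)); apply: val_inj.
rewrite bE raddf_sum; apply: eq_bigr => i _.
by rewrite mxE; apply: etrans (rmorphM \val _ _) _; rewrite rmorphXn.
Qed.
End PowerSpan.

(** * The two inclusions *)

Section Closures.
Variables (R : comPzSemiRingType) (A : semiringClosed R).
Hypothesis addRR : idempotent_op (@GRing.add R).

(** All monomials of [(a + y) ^+ n.+1] other than [y ^+ n.+1] have a factor [a],
    so they are below [a * (a + y) ^+ n]; the hypothesis deals with the last
    one.  Exchanging the factors [y] for [a + y] one at a time spares the
    binomial expansion. *)
Lemma exprD_eq_of_expr_le (y a : R) n :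
  add_le (y ^+ n.+1) (a * (a + y) ^+ n) ->
  (a + y) ^+ n.+1 = a * (a + y) ^+ n.
Proof.
move=> yz; set z := a + y in yz *.
suff yz_le r : (r <= n)%N -> add_le (y ^+ (n - r).+1 * z ^+ r) (a * z ^+ n).
  have := yz_le n (leqnn n); rewrite subnn expr1 /add_le addrC => zE.
  by rewrite exprS mulrDl.
elim: r => [|r IHr] rn; first by rewrite subn0 mulr1.
rewrite -subSn // subSS exprSr {2}/z mulrA mulrDr; apply: add_le_join.
  rewrite mulrC; apply: add_leM.
  have -> : z ^+ n = z ^+ r * z ^+ (n - r) by rewrite -exprD subnKC // ltnW.
  rewrite mulrC; apply: add_leM; apply: add_leX => //.
  exact: add_le_addr.
by rewrite mulrAC -exprSr; apply: IHr; apply: ltnW.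
Qed.

Lemma J_integral_le_fg (y : R) :
  J_integral A y -> exists2 z, fg_faithful_set A z & idem_le y z.
Proof.
case=> -[|n] [c [// _ cA yc]].
(* the summand [1] makes the powers of [a + y] increasing, which absorbs the
   lower powers of [y] into the highest one *)
pose a := 1 + \sum_i c i.
exists (a + y); last by rewrite /idem_le addrCA addRR.
apply: (fg_faithful_of_pow_eq (a := a) (n := n)).
  by rewrite rpredD ?rpred1 ?rpred_sum.
apply: exprD_eq_of_expr_le; apply: (add_le_trans yc); apply: add_le_sum_lub => i _.
apply: add_leM2.
  by apply: add_le_trans (add_le_addr addRR _ _); apply: add_le_sum.
apply: (@add_le_trans _ ((a + y) ^+ i)).
  by apply: add_leX => //; apply: add_le_addr.
apply: add_leX_exp; [exact: addRR | | by rewrite -ltnS].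
by apply: (add_le_trans (add_le_addl addRR _ _)); apply: add_le_addl.
Qed.

Lemma J_integral_of_fg (x : R) : fg_faithful_set A x -> J_integral A x.
Proof.
case=> M [faithM [n [f f_surj]]].
pose B := subsemiring (adjoin A x).
pose X : B := Subsemiring (mem_adjoin A x).
have addBB : idempotent_op (@GRing.add B) by move=> b; apply: val_inj; apply: addRR.
pose m i : M := f 'e_i.
have mE (v : 'rV[subsemiring A]_n) : f v = \sum_i adjoin_incl x (v 0 i) *: m i :> M.
  by rewrite [in LHS](row_sum_delta v) linear_sum; apply: eq_bigr => i _; rewrite linearZ.
have /choice[v vE] i : exists w, f w = X *: m i :> M by apply: f_surj.
pose c i j := adjoin_incl x (v i 0 j).
pose a' := \sum_i \sum_j v i 0 j.
pose a := adjoin_incl x a'.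
have c_le_a i j : add_le (c i j) a.
  rewrite /a !rmorph_sum.
  apply: add_le_trans (add_le_sum addBB _ i); rewrite rmorph_sum.
  exact: (add_le_sum addBB (c i) j).
have Xm i : X *: m i = \sum_j c i j *: m j by rewrite -vE mE.
have Xn : add_le (X ^+ n) (walk_bound n a X).
  apply: faithM => u; have [w <-] := f_surj u.
  rewrite mE !scaler_sumr; apply: eq_bigr => i _.
  rewrite !scalerA ![_ * adjoin_incl _ _]mulrC -!scalerA scalerDl.
  by rewrite (exprZ_le_walk_bound addBB Xm c_le_a i).
(* J-integrality asks for a positive degree, while a zero module has [n = 0]:
   multiplying by [X] covers both cases *)
exists n.+1, (fun l => val a' ^+ (n.+1 - l)); split=> // [i|].
  exact/rpredX/(valP a').
have: add_le (X ^+ n.+1) (walk_bound n.+1 a X).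
  rewrite walk_boundS exprS; apply: add_le_trans (add_le_addr addBB _ _).
  exact: add_leM.
have val_bound : val (walk_bound n.+1 a X)
    = \sum_(l < n.+1) val a' ^+ (n.+1 - l) * x ^+ l.
  rewrite raddf_sum; apply: eq_bigr => l _.
  by apply: etrans (rmorphM \val _ _) _; rewrite !rmorphXn.
move=> Xle; rewrite /idem_le -val_bound -[in RHS]Xle raddfD; congr (_ + _).
exact/esym/(rmorphXn \val).
Qed.
End Closures.

Theorem theorem1p2 (R : comPzSemiRingType) (A : semiringClosed R)
    (addRR : idempotent_op (@GRing.add R)) :
  D_closure A = down_closure (fg_faithful_set A).
Proof.
apply/seteqP; split=> x /=.
  case=> y /(J_integral_le_fg addRR)[z zX yz] xy.
  by exists z => //; apply: add_le_trans xy yz.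
by case=> y /(J_integral_of_fg addRR); exists y.
Qed.
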